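(* Let $\mu,\beta,\gamma$ be positive reals with $\gamma+\beta+\sqrt{\mu}<\frac{1}{2000}$. Let $G$ be a bipartite graph with bipartition $A\cup B$, $|A|=|B|=m$, minimum degree at least $\frac{m}{10}$ and $e(A,B)\ge(1-\beta)m^2$. Let $\mathcal{F}$ be a $\mu m$-bounded incompatibility system over $G$, and suppose $G$ has a perfect matching consisting of edges $e_1,\dots,e_m$. Then there exists a Hamilton cycle in $G$ containing the edges $e_1,\dots,e_{\gamma m}$ that is compatible with $\mathcal{F}$.
   Context: All graphs are finite and simple; $e(A,B)$ is the number of edges between $A$ and $B$. Floor signs are omitted as in the paper: $\gamma m$ is treated as an integer. An incompatibility system $\mathcal{F}$ over $G=(V,E)$ is a family $\{F_v\}_{v\in V}$ where each $F_v$ is a set of unordered pairs $\{e,e'\}$ of distinct edges with $e\cap e'=\{v\}$; edges $e,e'$ are incompatible if $\{e,e'\}\in F_v$ for some $v$, compatible otherwise. A cycle is compatible with $\mathcal{F}$ if every pair of its edges is compatible. For a positive real $\Delta$, $\mathcal{F}$ is $\Delta$-bounded if for every vertex $v$ and edge $e\ni v$, at most $\Delta$ other edges $e'\ni v$ satisfy $\{e,e'\}\in F_v$.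
   Formalization: The formal theorem assumes m ≥ 2; for m = 1 (a single edge) all hypotheses hold but a simple graph on two vertices has no Hamilton cycle, and m = 0 is likewise excluded. *)

(* Defs.v *)
From HB Require Import structures.
From mathcomp Require Import all_boot all_order all_algebra.
From mathcomp Require Import reals.
Set Implicit Arguments. Unset Strict Implicit. Unset Printing Implicit Defensive.
Import Order.TTheory GRing.Theory Num.Theory.

Section Graphs.
Variable V : finType.

Definition simple_graph (adj : rel V) : Prop :=
  symmetric adj /\ irreflexive adj.

Definition is_edge (adj : rel V) (e : {set V}) : bool :=
  [exists x, exists y, adj x y && (e == [set x; y])].

Definition degree (adj : rel V) (v : V) : nat := #|[set u | adj v u]|.

Definition e_between (adj : rel V) (A B : {set V}) : nat :=
  #|[set p : V * V | [&& p.1 \in A, p.2 \in B & adj p.1 p.2]]|.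

Definition bipartition (adj : rel V) (A B : {set V}) : Prop :=
  [/\ A :&: B = set0, A :|: B = [set: V] &
      forall x y, adj x y -> ((x \in A) && (y \in B)) || ((x \in B) && (y \in A))].

Definition perfect_matching (adj : rel V) (M : seq {set V}) : Prop :=
  [/\ forall e, e \in M -> is_edge adj e,
      forall i j, i < size M -> j < size M -> i != j ->
        nth set0 M i :&: nth set0 M j = set0 &
      forall v, exists2 e, e \in M & v \in e].

(* incompatibility system: F v e e' means {e,e'} \in F_v (unordered pairs
   represented by a symmetric relation) *)
Definition incompat_system (adj : rel V) (F : V -> {set V} -> {set V} -> bool) : Prop :=
  forall v e e', F v e e' ->
    [/\ F v e' e, is_edge adj e, is_edge adj e', e != e' & e :&: e' = [set v]].

Definition incompatible (F : V -> {set V} -> {set V} -> bool) (e e' : {set V}) : bool :=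
  [exists v, F v e e' || F v e' e].

Definition bounded_sys (R : realType) (F : V -> {set V} -> {set V} -> bool)
  (adj : rel V) (Delta : R) : Prop :=
  forall v e, is_edge adj e -> v \in e ->
    (#|[set e' | F v e e']|%:R <= Delta)%R.

Definition cycle_edges (s : seq V) : seq {set V} :=
  [seq [set p.1; p.2] | p <- zip s (rot 1 s)].

Definition hamilton_cycle (adj : rel V) (s : seq V) : Prop :=
  [/\ 2 < size s, uniq s, forall v, v \in s & cycle adj s].

Definition compatible_cycle (F : V -> {set V} -> {set V} -> bool) (s : seq V) : Prop :=
  forall e e', e \in cycle_edges s -> e' \in cycle_edges s -> e != e' ->
    ~~ incompatible F e e'.

End Graphs.

(* Main.v *)
(** Let [f0] pair the ends of every edge of [M].  Call a vertex defective if it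
    misses more than [m/10] vertices of the other side, or if more than
    [sqrt mu * m] of its edges [uv] are incompatible at [u] with the edge of [M]
    at [u]; by double counting there are at most [m/100] defective vertices.
    Every defective [v] keeps its matching edge and is given a fresh neighbour
    [w] that is rematched to some [z], the old partners of [w] and [z] being
    matched together; so [v] has a compatible edge outside the matching.
    For the new matching [f], consider the digraph on [A] with an arc [a -> a']
    when [f a] and [a'] are joined by an edge compatible with both matching
    edges at its ends: a directed Hamilton cycle becomes, after replacing each
    [a] by [a, f a], a compatible Hamilton cycle.  Contracting the prescribed
    arcs at defective vertices leaves a digraph that misses few arcs at every
    vertex, and a cyclic order with the fewest missing arcs is Hamiltonian. *)
Require Import Defs.
From HB Require Import structures.
From mathcomp Require Import all_boot all_order all_algebra.
From mathcomp Require Import reals zify ring lra.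
Set Implicit Arguments. Unset Strict Implicit. Unset Printing Implicit Defensive.
Import Order.TTheory GRing.Theory Num.Theory.

(** * Hamilton cycles of dense digraphs by local exchange *)

Section DenseCycle.
Variables (T : eqType) (e : rel T).

(** Taken with [x] the last element of [s], this is the number of missing arcs of the cyclic order
    [s]. *)
Definition defects (x : T) (s : seq T) : nat :=
  count negb (pairmap e x s).

Lemma defects_cat x s1 s2 :
  defects x (s1 ++ s2) = defects x s1 + defects (last x s1) s2.
Proof. by rewrite /defects pairmap_cat count_cat. Qed.

Lemma defects_eq0 x s : defects x s = 0 -> path e x s.
Proof.
elim: s x => [|y s IHs] x //=; rewrite /defects /=.
by case: (e x y) => //= /IHs.
Qed.

Lemma defects_gt0 x s : 0 < defects x s ->
  exists L y R, s = L ++ y :: R /\ ~~ e (last x L) y.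
Proof.
elim: s x => [|y s IHs] x //; rewrite /defects /=.
case Exy: (e x y) => /=; last by move=> _; exists [::], y, s; rewrite /= Exy.
move=> /IHs[L [z [R [-> H]]]]; by exists (y :: L), z, R.
Qed.

Lemma nth_count_lt (P : pred T) (x0 : T) s i n d :
  i + n <= size s -> count P s <= d -> d < n ->
  exists2 j, i <= j < i + n & ~~ P (nth x0 s j).
Proof.
move=> Hn Hc Hd.
have Ht : size (take n (drop i s)) = n by rewrite size_takel // size_drop; lia.
have : has (predC P) (take n (drop i s)).
  rewrite has_count -[X in 0 < X](addKn (count P (take n (drop i s)))).
  rewrite count_predC Ht subn_gt0 (leq_ltn_trans _ Hd) // (leq_trans _ Hc) //.
  rewrite -{2}(cat_take_drop i s) -{2}(cat_take_drop n (drop i s)) !count_cat.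
  lia.
case/(has_nthP x0) => j; rewrite Ht => Hj /=; rewrite nth_take // nth_drop => HP.
by exists (i + j); rewrite ?HP //; lia.
Qed.

(* Rearranging the cyclic order P1 P2 P3 into P1 P3 P2 keeps every consecutive
   pair but three, so a bad closing pair can be traded for three arcs. *)
Lemma three_exchange d (x1 : T) q :
  let c := x1 :: q in
  5 * d < size c ->
  (forall x, x \in c -> count (fun y => ~~ e x y) c <= d) ->
  (forall x, x \in c -> count (fun y => ~~ e y x) c <= d) ->
  ~~ e (last x1 q) x1 ->
  exists2 c', perm_eq c' c & defects (last x1 c') c' < defects (last x1 c) c.
Proof.
move=> c Hd Ho Hi Hx.
have lc : last x1 q \in c by rewrite mem_last.
have d_gt0 : 0 < d.
  apply: leq_trans (Ho _ lc); rewrite -has_count; apply/hasP.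
  by exists x1 => //; rewrite mem_head.
(* First cut: among the [d.+1] positions from 1 on, one receives an arc from the last vertex.
   Starting at 1 keeps the first piece nonempty, and [d_gt0] makes [c] long enough. *)
have [||i /andP[i_gt0 i_le] ei] := nth_count_lt (i := 1) (n := d.+1) x1 _ (Ho _ lc).
- lia.
- lia.
rewrite negbK in ei.
have ui : nth x1 c i.-1 \in c by apply: mem_nth; lia.
(* [P j] says that a second cut after position [j] spoils one of the other two new arcs. At most
   [2 * d] positions are bad, while at least [4 * d - 1] are available since [i <= d.+1]. *)
pose P j := ~~ e (nth x1 c j) x1 || ~~ e (nth x1 c i.-1) (nth x1 c j.+1).
have [j [j_ge j_lt /norP[]]] : exists j, [/\ i <= j, j.+1 < size c & ~~ P j].
  pose s := iota i (size c - i.+1).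
  suff : has (predC P) s.
    case/hasP=> j; rewrite mem_iota => Hj HP; exists j; split=> //; lia.
  rewrite has_count -(ltn_add2l (count P s)) count_predC addn0 size_iota.
  have le1 : count (fun j => ~~ e (nth x1 c j) x1) s <= d.
    apply: leq_trans (Hi x1 (mem_head _ _)).
    rewrite -[X in _ <= count _ X](mkseq_nth x1 c) /mkseq count_map.
    have -> : iota 0 (size c) = iota 0 i ++ s ++ iota (size c).-1 1.
      have {1}-> : size c = i + ((size c - i.+1) + 1) by lia.
      by rewrite !iotaD add0n; congr (_ ++ (_ ++ iota _ _)); lia.
    rewrite !count_cat; set a := count _ s; lia.
  have le2 : count (fun j => ~~ e (nth x1 c i.-1) (nth x1 c j.+1)) s <= d.
    apply: leq_trans (Ho _ ui).
    rewrite -[X in _ <= count _ X](mkseq_nth x1 c) /mkseq count_map.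
    have -> : iota 0 (size c) = iota 0 i.+1 ++ map S s.
      have {1}-> : size c = i.+1 + (size c - i.+1) by lia.
      by rewrite iotaD add0n /s -[S]/(addn 1) -iotaDl.
    rewrite count_cat count_map.
    set a := count _ s; lia.
  have := count_predUI (fun j => ~~ e (nth x1 c j) x1)
    (fun j => ~~ e (nth x1 c i.-1) (nth x1 c j.+1)) s.
  rewrite -[count (predU _ _) s]/(count P s); lia.
rewrite !negbK => ej eij.
have E1 : take i c = x1 :: take i.-1 q by rewrite /c -[in LHS](prednK i_gt0).
have E2 : take (j.+1 - i) (drop i c) =
          nth x1 c i :: behead (take (j.+1 - i) (drop i c)).
  have Hic : i < size c by lia.
  by rewrite (drop_nth x1 Hic) subSn.
have E3 : drop j.+1 c = nth x1 c j.+1 :: drop j.+2 c by rewrite (drop_nth x1).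
set P1 := take i c in E1; set P2 := take _ _ in E2; set P3 := drop _ c in E3.
have Ec : c = P1 ++ P2 ++ P3.
  rewrite -[LHS](cat_take_drop i); congr (_ ++ _).
  rewrite -[LHS](cat_take_drop (j.+1 - i)); congr (_ ++ _).
  by rewrite drop_drop; congr drop; lia.
have l1 z : last z P1 = nth x1 c i.-1.
  rewrite [in LHS]E1 /= (last_nth x1) -E1.
  have -> : size (take i.-1 q) = i.-1.
    by rewrite size_takel //; move: j_lt; rewrite /c /=; lia.
  by rewrite nth_take //; lia.
have l2 z : last z P2 = nth x1 c j.
  rewrite E2 /= (last_nth x1) -E2.
  have -> : size (behead P2) = (j - i).
    by rewrite size_behead /P2 size_takel ?size_drop; lia.
  by rewrite nth_take ?nth_drop; [congr nth|]; lia.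
have l3 z : last z P3 = last x1 q.
  by rewrite -[RHS]/(last z c) Ec !last_cat {1}E3 [in RHS]E3.
exists (P1 ++ P3 ++ P2).
  by rewrite [X in perm_eq _ X]Ec perm_cat2l perm_catC.
rewrite [X in _ < defects _ X]Ec [X in _ < defects (last _ X) _]Ec.
rewrite !last_cat !defects_cat !l1 !l2 !l3 E1 E2 E3.
rewrite /defects /= ej eij ei Hx /=; lia.
Qed.

(** Induction on a bound for the number of missing arcs: rotation moves a missing arc to the closing
    place, where [three_exchange] lowers the count. *)
Lemma dense_cycle d s : uniq s -> 5 * d < size s ->
  (forall x, x \in s -> count (fun y => ~~ e x y) s <= d) ->
  (forall x, x \in s -> count (fun y => ~~ e y x) s <= d) ->
  exists2 c, perm_eq c s & cycle e c.
Proof.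
move=> Us Hd Ho Hi.
case: s => [|x0 s0] // in Us Hd Ho Hi *; set s := x0 :: s0 in Us Hd Ho Hi *.
suff H n c : perm_eq c s -> defects (last x0 c) c <= n ->
    exists2 c', perm_eq c' s & cycle e c'.
  exact: H (perm_refl s) (leqnn _).
elim: n c => [|n IHn] c Hc.
  rewrite leqn0 => /eqP/defects_eq0 Hp; exists c => //.
  case: c Hc Hp => [|x c] // _ /= /andP[H1 H2].
  by rewrite rcons_path H2.
case: (posnP (defects (last x0 c) c)) => [E _|]; first by apply: (IHn c) => //; rewrite E.
case/defects_gt0 => L [y [R [Ec Hy]]] Hn.
have Hc2 : perm_eq (y :: R ++ L) s.
  by rewrite -cat_cons perm_catC -Ec.
have [||||c' Hc' Hlt] := @three_exchange d y (R ++ L).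
- by rewrite (perm_size Hc2).
- by move=> x; rewrite (perm_mem Hc2) => /Ho; rewrite (permP Hc2).
- by move=> x; rewrite (perm_mem Hc2) => /Hi; rewrite (permP Hc2).
- by move: Hy; rewrite Ec last_cat /= last_cat.
apply: (IHn c'); first exact: perm_trans Hc' Hc2.
have c'_n : c' <> [::] by move=> E; move: (perm_size Hc'); rewrite E.
have -> : last x0 c' = last y c' by case: (c') c'_n.
rewrite -ltnS; apply: leq_trans Hlt (leq_trans _ Hn).
by rewrite Ec -cat_cons !defects_cat !last_cat addnC.
Qed.

End DenseCycle.

Lemma count_enum (T : finType) (P : pred T) (C : {set T}) :
  count P (enum C) = #|[set x in C | P x]|.
Proof.
by rewrite -sum1_count big_enum_cond -sum1_card; apply: eq_bigl => x; rewrite inE.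
Qed.

(** * Hamilton cycles through prescribed arcs by contraction *)

Section BlockCycle.
Variables (T : finType) (e : rel T) (S Xo Xi : {set T}) (so si : T -> T).

(* The path [si x -> x -> so x], without [si x] (resp. [so x]) when [x] is not
   in [Xi] (resp. [Xo]). *)
Definition block_start x := if x \in Xi then si x else x.
Definition block_end x := if x \in Xo then so x else x.
Definition block_tail x :=
  (if x \in Xi then [:: x] else [::]) ++ (if x \in Xo then [:: so x] else [::]).
Definition block x := block_start x :: block_tail x.

Lemma last_block x : last (block_start x) (block_tail x) = block_end x.
Proof. by rewrite /block_start /block_tail /block_end; do 2!case: ifP. Qed.

Lemma path_block x :
  (forall x, x \in Xo -> e x (so x)) -> (forall x, x \in Xi -> e (si x) x) ->
  path e (block_start x) (block_tail x).
Proof.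
move=> Hso Hsi; rewrite /block_start /block_tail.
by case: ifP => [/Hsi|] /= Ei; case: ifP => [/Hso|] /= Eo; rewrite ?Ei ?Eo.
Qed.

Lemma cycle_flatten c :
  (forall x, x \in Xo -> e x (so x)) -> (forall x, x \in Xi -> e (si x) x) ->
  cycle (fun x y => e (block_end x) (block_start y)) c ->
  cycle e (flatten (map block c)).
Proof.
move=> Hso Hsi; case: c => [|x c] //.
suff H y : path (fun x y => e (block_end x) (block_start y)) y (rcons c x) ->
    path e (block_end y) (rcons (flatten (map block c)) (block_start x)).
  rewrite [cycle _ (x :: c)]/= => /H {H}.
  have -> : flatten (map block (x :: c)) =
    block_start x :: block_tail x ++ flatten (map block c) by [].
  by rewrite /cycle rcons_cat cat_path path_block // last_block.
elim: c y => [|z c IHc] y //.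
rewrite [rcons (z :: c) x]/= [path _ y _]/= => /andP[Hyz /IHc].
have -> : flatten (map block (z :: c)) =
  block_start z :: block_tail z ++ flatten (map block c) by [].
rewrite rcons_cons [path _ _ (_ :: _)]/= Hyz rcons_cat.
by rewrite cat_path path_block // last_block.
Qed.

(** Blocks end outside [Xo] and start outside [Xi], so the bounds assumed only there control all
    arcs between blocks, and more than [5 * d] blocks remain for [dense_cycle]. *)
Lemma block_cycle d :
  Xo \subset S -> Xi \subset S ->
  (forall x, x \in Xo -> [/\ so x \in S, so x \notin Xo, so x \notin Xi & e x (so x)]) ->
  (forall x, x \in Xi -> [/\ si x \in S, si x \notin Xo, si x \notin Xi & e (si x) x]) ->
  {in Xo &, injective so} -> {in Xi &, injective si} ->
  (forall x y, x \in Xo -> y \in Xi -> so x != si y) ->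
  (forall x, x \in S -> x \notin Xo -> #|[set y in S | ~~ e x y]| <= d) ->
  (forall x, x \in S -> x \notin Xi -> #|[set y in S | ~~ e y x]| <= d) ->
  5 * d + (#|Xo| + #|Xi|) < #|S| ->
  exists c, [/\ uniq c, c =i S & cycle e c].
Proof.
move=> XoS XiS Hso Hsi Iso Isi Dsoi Do Di Hd.
have so_e x : x \in Xo -> e x (so x) by case/Hso.
have si_e x : x \in Xi -> e (si x) x by case/Hsi.
(* Each vertex of [S] that is not a prescribed neighbour represents its own block. *)
pose C := S :\: ((so @: Xo) :|: (si @: Xi)).
have XoC x : x \in Xo -> x \in C.
  move=> Hx; rewrite !inE (subsetP XoS) // andbT; apply/norP; split.
    by apply/imsetP=> -[y /Hso[_ H _ _] E]; rewrite -E Hx in H.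
  by apply/imsetP=> -[y /Hsi[_ H _ _] E]; rewrite -E Hx in H.
have XiC x : x \in Xi -> x \in C.
  move=> Hx; rewrite !inE (subsetP XiS) // andbT; apply/norP; split.
    by apply/imsetP=> -[y /Hso[_ _ H _] E]; rewrite -E Hx in H.
  by apply/imsetP=> -[y /Hsi[_ _ H _] E]; rewrite -E Hx in H.
have CS x : x \in C -> x \in S by rewrite inE => /andP[].
have start_in x : x \in C -> (block_start x \in S) && (block_start x \notin Xi).
  rewrite /block_start; case: ifP => [/Hsi[-> _ ->] // | /negbT-> /CS->] //.
have end_in x : x \in C -> (block_end x \in S) && (block_end x \notin Xo).
  rewrite /block_end; case: ifP => [/Hso[-> ->] // | /negbT-> /CS->] //.
(* Distinct blocks have distinct starts, and likewise distinct ends, so missing arcs between blocks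
   inject into missing arcs of [e]. *)
have start_inj : {in C &, injective block_start}.
  move=> x y Hx Hy; rewrite /block_start; do 2!case: ifP => // ?.
  - exact: Isi.
  - by move=> E; move: Hy; rewrite -E !inE imset_f // orbT.
  - by move=> E; move: Hx; rewrite E !inE imset_f // orbT.
have end_inj : {in C &, injective block_end}.
  move=> x y Hx Hy; rewrite /block_end; do 2!case: ifP => // ?.
  - exact: Iso.
  - by move=> E; move: Hy; rewrite -E !inE imset_f.
  - by move=> E; move: Hx; rewrite E !inE imset_f.
have cardC : #|C| + (#|Xo| + #|Xi|) = #|S|.
  have -> : #|Xo| + #|Xi| = #|(so @: Xo) :|: (si @: Xi)|.
    rewrite cardsU !card_in_imset //.
    suff -> : (so @: Xo) :&: (si @: Xi) = set0 by rewrite cards0 subn0.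
    apply/setP=> z; rewrite !inE; apply/negP=> /andP[/imsetP[x Hx ->] /imsetP[y Hy]].
    by apply/eqP/Dsoi.
  rewrite -(cardsID ((so @: Xo) :|: (si @: Xi)) S) addnC; congr (_ + _).
  rewrite (setIidPr _) // subUset.
  apply/andP; split; apply/subsetP=> z /imsetP[x].
    by move=> /Hso[H _ _ _] ->.
  by move=> /Hsi[H _ _ _] ->.
pose e' x y := e (block_end x) (block_start y).
have [||||c' Pc Cc] := @dense_cycle _ e' d (enum C).
- exact: enum_uniq.
- by rewrite -cardE; lia.
- move=> x; rewrite mem_enum => /end_in/andP[H1 H2]; apply: leq_trans (Do _ H1 H2).
  rewrite count_enum -(card_in_imset (f := block_start)); last first.
    by move=> y z /setIdP[Hy _] /setIdP[Hz _]; apply: start_inj.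
  apply/subset_leq_card/subsetP=> z /imsetP[y /setIdP[/start_in/andP[Hz _] Hy] ->].
  by rewrite inE Hz.
- move=> x; rewrite mem_enum => /start_in/andP[H1 H2]; apply: leq_trans (Di _ H1 H2).
  rewrite count_enum -(card_in_imset (f := block_end)); last first.
    by move=> y z /setIdP[Hy _] /setIdP[Hz _]; apply: end_inj.
  apply/subset_leq_card/subsetP=> z /imsetP[y /setIdP[/end_in/andP[Hz _] Hy] ->].
  by rewrite inE Hz.
have c'C x : (x \in c') = (x \in C) by rewrite (perm_mem Pc) mem_enum.
set c := flatten (map block c').
have Sc : {subset enum S <= c}.
  move=> x; rewrite mem_enum => HxS; apply/flatten_mapP.
  case: (boolP (x \in C)) => [HC|].
    exists x; rewrite ?c'C // /block /block_start /block_tail !inE.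
    by case: ifP; rewrite ?inE ?eqxx ?orbT.
  rewrite inE HxS andbT negbK => /setUP[]/imsetP[y Hy ->]; exists y.
  - by rewrite c'C XoC.
  - by rewrite /block /block_tail Hy inE mem_cat inE eqxx !orbT.
  - by rewrite c'C XiC.
  - by rewrite /block /block_start Hy mem_head.
(* A list that covers [S] with at most [#|S|] entries has no repetition; this count replaces a check
   that the blocks are disjoint. *)
have size_c : size c <= size (enum S).
  rewrite -cardE -cardC size_flatten /shape -map_comp sumnE big_map.
  rewrite (perm_big _ Pc) /= big_enum /=.
  apply: (@leq_trans (\sum_(x in C) (1 + ((x \in Xi) + (x \in Xo))))).
    apply: leq_sum => x _; rewrite /block_tail size_cat.
    by do 2!case: ifP.
  rewrite big_split sum1_card leq_add2l big_split addnC /= -!big_mkcondr.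
  have le (Y : {set T}) : {subset Y <= C} -> \sum_(x in C | x \in Y) 1 <= #|Y|.
    by move=> YC; rewrite -sum1_card (eq_bigl (mem Y)) // => x; apply/andb_idl/YC.
  by apply: leq_add; apply: le.
exists c; split.
- exact: leq_size_uniq (enum_uniq _) Sc size_c.
- move=> x; have [_ E] := uniq_min_size (enum_uniq _) Sc size_c.
  by rewrite -E mem_enum.
- exact: cycle_flatten.
Qed.

End BlockCycle.

(** * Consecutive pairs of a cyclic list and of its expansion *)

Section CyclicPairs.
Variable T : eqType.

Lemma cycle_zip (e : rel T) c :
  cycle e c = all (fun p => e p.1 p.2) (zip c (rot 1 c)).
Proof.
case: c => [|x c] //; rewrite rot1_cons /cycle.
by elim: c {1 3}x => [|z c IHc] y //=; rewrite IHc.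
Qed.

Lemma zip_uniq1 (s t : seq T) p q : uniq s -> size s = size t ->
  p \in zip s t -> q \in zip s t -> p.1 = q.1 -> p = q.
Proof.
move=> Us Hs /(nthP p)[i Hi <-] /(nthP p)[j Hj <-].
rewrite !size_zip -Hs minnn in Hi Hj; case: p => x y; rewrite !nth_zip //=.
by move/eqP; rewrite nth_uniq // => /eqP->.
Qed.

Lemma zip_uniq2 (s t : seq T) p q : uniq t -> size s = size t ->
  p \in zip s t -> q \in zip s t -> p.2 = q.2 -> p = q.
Proof.
move=> Us Hs /(nthP p)[i Hi <-] /(nthP p)[j Hj <-].
rewrite !size_zip Hs minnn in Hi Hj; case: p => x y; rewrite !nth_zip //=.
by move/eqP; rewrite nth_uniq // => /eqP->.
Qed.

Lemma mem_zip12 (s t : seq T) p : size s = size t ->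
  p \in zip s t -> p.1 \in s /\ p.2 \in t.
Proof.
move=> Hs /(nthP p)[i Hi <-]; rewrite !size_zip Hs minnn in Hi.
by case: p => x y; rewrite !nth_zip //= !mem_nth // Hs.
Qed.

Definition expand (f : T -> T) (c : seq T) := flatten [seq [:: a; f a] | a <- c].

Lemma mem_expand f c x : (x \in expand f c) = (x \in c) || (x \in map f c).
Proof.
elim: c => [|a c IHc] //; rewrite /= !inE IHc.
by case: (x == a); case: (x == f a); case: (x \in c).
Qed.

Lemma size_expand f c : size (expand f c) = (size c).*2.
Proof. by elim: c => [|a c IHc] //=; rewrite IHc. Qed.

Lemma uniq_expand f c : injective f -> uniq c ->
  (forall a b, a \in c -> b \in c -> a <> f b) -> uniq (expand f c).
Proof.
move=> If; elim: c => [|a c IHc] // /andP[Ha Uc] Hf.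
rewrite -[expand f _]/(a :: f a :: expand f c) 2!cons_uniq inE !mem_expand.
rewrite mem_map // !negb_or Ha IHc //; last first.
  by move=> x y Hx Hy; apply: Hf; rewrite inE (Hx, Hy) orbT.
rewrite !andbT !andTb -andbA; apply/and3P; split.
- by apply/eqP; apply: Hf; rewrite mem_head.
- by rewrite /=; apply/mapP=> -[b Hb]; apply: Hf; rewrite inE ?eqxx ?Hb ?orbT.
- by apply/negP=> H; apply: (Hf (f a) a); rewrite ?inE ?eqxx ?H ?orbT.
Qed.

(** Checks on the expanded cycle become a case split between matching pairs and linking pairs. *)
Lemma zip_expand f c p :
  (p \in zip (expand f c) (rot 1 (expand f c))) =
  (p \in [seq (a, f a) | a <- c]) ||
  (p \in [seq (f q.1, q.2) | q <- zip c (rot 1 c)]).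
Proof.
case: c => [|x c] //.
suff H y : (p \in zip (expand f (x :: c)) (rcons (f x :: expand f c) y)) =
    (p \in [seq (a, f a) | a <- x :: c]) ||
    (p \in [seq (f q.1, q.2) | q <- zip (x :: c) (rcons c y)]).
  by rewrite -[expand f (x :: c)]/(x :: f x :: expand f c) !rot1_cons -H.
elim: c x => [|z c IHc] x; first by rewrite /= !inE.
have -> : zip (expand f (x :: z :: c)) (rcons (f x :: expand f (z :: c)) y) =
  (x, f x) :: (f x, z) :: zip (expand f (z :: c)) (rcons (f z :: expand f c) y) by [].
rewrite 2!inE IHc [map _ (x :: _)]/= [map _ (zip (x :: _) _)]/= !inE.
by case: (p == (x, f x)); case: (p == (f x, z)); rewrite ?orbT.
Qed.

End CyclicPairs.

(** * From directed cycles on [A] to compatible Hamilton cycles *)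

Section Links.
Variables (V : finType) (adj : rel V) (A : {set V}).
Variable F : V -> {set V} -> {set V} -> bool.
Hypothesis adj_sym : symmetric adj.
Hypothesis adj_side : forall x y, adj x y -> (x \in A) = (y \notin A).
Hypothesis F_sys : incompat_system adj F.

(** On the expanded cycle a linking edge is adjacent only to the matching edges at its two ends, so
    these are the only conflicts to exclude. *)
Definition link (f : V -> V) x y :=
  [&& adj x y, ~~ F x [set x; f x] [set x; y] & ~~ F y [set y; f y] [set y; x]].

Lemma F_sym v e e' : F v e e' -> F v e' e.
Proof. by case/F_sys. Qed.

(** Incompatible edges share exactly one vertex. Distinct matching edges are disjoint, distinct
    linking edges are disjoint because [c] has no repetition, and a matching edge meeting a linking
    edge is covered by [link]. *)
Lemma link_cycle (f : V -> V) (c : seq V) :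
  involutive f -> (forall v, adj v (f v)) ->
  uniq c -> c =i A -> 1 < #|A| ->
  cycle (fun a a' => link f (f a) a') c ->
  [/\ hamilton_cycle adj (expand f c),
      forall v, [set v; f v] \in cycle_edges (expand f c) &
      compatible_cycle F (expand f c)].
Proof.
move=> fK adjf Uc cA A_gt1 Cc.
have f_side v : (f v \in A) = (v \notin A) by rewrite (adj_side (adjf v)) negbK.
have f_inj := can_inj fK.
have size_rot1 : size c = size (rot 1 c) by rewrite size_rot.
have link_zip q : q \in zip c (rot 1 c) -> link f (f q.1) q.2.
  by move: Cc; rewrite cycle_zip => /allP; apply.
have zipA q : q \in zip c (rot 1 c) -> q.1 \in A /\ q.2 \in A.
  by move/(mem_zip12 size_rot1) => []; rewrite mem_rot !cA.
have edgesP e : e \in cycle_edges (expand f c) ->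
    (exists2 a, a \in A & e = [set a; f a]) \/
    (exists2 q, q \in zip c (rot 1 c) & e = [set f q.1; q.2]).
  case/mapP=> p; rewrite zip_expand => /orP[] /mapP[x Hx ->] ->; [left|right].
    by exists x; rewrite // -cA.
  by exists x.
have size_c : size c = #|A| by rewrite -(card_uniqP Uc); apply: eq_card.
split.
- split.
  + by rewrite size_expand size_c; lia.
  + apply: uniq_expand => // a b; rewrite !cA => Ha Hb E.
    by move: (f_side b); rewrite -E Ha Hb.
  + move=> v; rewrite mem_expand cA; case: (boolP (v \in A)) => //= Hv.
    by rewrite -[v]fK map_f // cA f_side.
  + rewrite cycle_zip; apply/allP=> p; rewrite zip_expand => /orP[] /mapP[x Hx ->] //=.
    by case/and3P: (link_zip _ Hx).
- have aux a : a \in A -> [set a; f a] \in cycle_edges (expand f c).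
    move=> Ha; apply/mapP; exists (a, f a) => //; rewrite zip_expand.
    by rewrite (map_f (fun a => (a, f a))) // cA.
  move=> v; case: (boolP (v \in A)) => [/aux //|Hv].
  by rewrite -{1}[v]fK setUC aux // f_side.
- suff H v e e' : e \in cycle_edges (expand f c) -> e' \in cycle_edges (expand f c) ->
      ~~ F v e e'.
    move=> e e' He He' _; apply/existsP => -[v /orP[]]; apply/negP; exact: H.
  have mixed v0 a q : a \in A -> q \in zip c (rot 1 c) ->
      ~~ F v0 [set a; f a] [set f q.1; q.2].
    move=> Ha Hq; apply/negP => HF; have [_ _ _ _ EI] := F_sys HF.
    have [q1 q2] := zipA _ Hq; have /and3P[_ L1 L2] := link_zip _ Hq.
    have : v0 \in [set a; f a] :&: [set f q.1; q.2] by rewrite EI set11.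
    rewrite !inE => /andP[/orP[]/eqP Ev /orP[]/eqP Ev']; subst v0.
    + by move: Ha; rewrite Ev' f_side q1.
    + rewrite -Ev' [X in F a _ X]setUC in HF.
      by move: L2; rewrite -Ev' HF.
    + have Ea := f_inj _ _ Ev'; rewrite -Ea [X in F _ X]setUC in HF.
      by move: L1; rewrite -Ea fK HF.
    + by move: (f_side a); rewrite Ev' q2 Ha.
  move=> /edgesP[[a Ha ->]|[q Hq ->]] /edgesP[[a' Ha' ->]|[q' Hq' ->]].
  + apply/negP=> HF; have [_ _ _ Ne EI] := F_sys HF.
    have : v \in [set a; f a] :&: [set a'; f a'] by rewrite EI set11.
    rewrite !inE => /andP[/orP[]/eqP Ev /orP[]/eqP Ev'].
    * by move: Ne; rewrite -Ev Ev' eqxx.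
    * by move: (f_side a'); rewrite -Ev' Ev Ha Ha'.
    * by move: (f_side a); rewrite -Ev Ev' Ha Ha'.
    * by move: Ne; rewrite (f_inj a a') ?eqxx // -Ev.
  + exact: mixed.
  + by apply/negP => /F_sym; apply/negP/mixed.
  + apply/negP=> HF; have [_ _ _ Ne EI] := F_sys HF.
    have [q1 q2] := zipA _ Hq; have [q1' q2'] := zipA _ Hq'.
    have : v \in [set f q.1; q.2] :&: [set f q'.1; q'.2] by rewrite EI set11.
    rewrite !inE => /andP[/orP[]/eqP Ev /orP[]/eqP Ev'].
    * by move: Ne; rewrite (zip_uniq1 Uc size_rot1 Hq Hq') ?eqxx //; apply: f_inj; rewrite -Ev.
    * by move: (f_side q.1); rewrite -Ev Ev' q1 q2'.
    * by move: (f_side q'.1); rewrite -Ev' Ev q1' q2.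
    * by move: Ne; rewrite (zip_uniq2 _ size_rot1 Hq Hq') ?eqxx ?rot_uniq // -Ev.
Qed.

(** * Rerouting the matching around defective vertices *)

Variables (m D t r k x : nat) (f0 : V -> V) (K : {set V}).
Hypothesis cardA : #|A| = m.
Hypothesis cardB : #|~: A| = m.
Hypothesis F_bound :
  forall v e, is_edge adj e -> v \in e -> #|[set e' | F v e e']| <= D.
Hypothesis f0K : involutive f0.
Hypothesis adj_f0 : forall v, adj v (f0 v).
Hypothesis K_f0 : forall v, (f0 v \in K) = (v \in K).
Hypothesis cardK : #|K| <= 2 * k.

Definition miss v := #|[set y | ((y \in A) != (v \in A)) && ~~ adj v y]|.
(** Conflicts at [v] with a given edge are at most [D] for every [v]; those at the far end, counted
    here, are small only on average over [v]. *)
Definition back v := #|[set u | adj v u && F u [set u; f0 u] [set u; v]]|.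
Definition defective := [set v | (t < miss v) || (r < back v)].

Hypothesis card_defective : #|defective| <= x.
(** The three bounds leave room, in turn, for the fresh neighbour [w] of a defective vertex, for its
    new partner [z], and for the contracted digraph. *)
Hypothesis large_degree : forall v, D + 6 * x + 2 * k < degree adj v.
Hypothesis large_m : 2 * t + D + 6 * x + 2 * k < m.
Hypothesis very_large_m : 5 * (t + D + r + 4 * x) + 2 * x < m.

Lemma degree_miss v : degree adj v + miss v = m.
Proof.
have side_card : #|[set y | (y \in A) != (v \in A)]| = m.
  case: (boolP (v \in A)) => Hv; [rewrite -cardB | rewrite -cardA];
  by apply: eq_card => y; rewrite !inE; case: (y \in A).
rewrite -[RHS]side_card -(cardsID [set u | adj v u]); congr (_ + _).
  apply: eq_card => y; rewrite !inE; case: (boolP (adj v y)); rewrite ?andbF //.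
  by move/adj_side ->; case: (y \in A).
by apply: eq_card => y; rewrite !inE andbC.
Qed.

Lemma set2_inj (v : V) : injective (fun y => [set v; y]).
Proof.
move=> y z /setP E; move: (E y) (E z); rewrite !inE !eqxx !orbT.
by case: (eqVneq y v) => [->|_] /=; case: (eqVneq z v) => [->|_] //= => /esym/eqP.
Qed.

Lemma card_incompatible u v : adj v u ->
  #|[set y | F v [set v; u] [set v; y]]| <= D.
Proof.
move=> Hvu; rewrite -(card_imset _ (@set2_inj v)).
have He : is_edge adj [set v; u].
  by apply/existsP; exists v; apply/existsP; exists u; rewrite Hvu eqxx.
apply: leq_trans (F_bound He (set21 v u)); apply: subset_leq_card.
by apply/subsetP=> e /imsetP[y]; rewrite !inE => H ->.
Qed.

Lemma exists_outside (N P : {set V}) : #|P| < #|N| -> exists2 y, y \in N & y \notin P.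
Proof.
move=> H; have /subsetPn[y Hy Py] : ~~ (N \subset P).
  by apply: contraL H => /subset_leq_card; rewrite -leqNgt.
by exists y.
Qed.

(** Switches the matching along the alternating 4-cycle [w, z, f z, f w]. *)
Definition swap (f : V -> V) w z u :=
  if u == w then z else if u == z then w
  else if u == f w then f z else if u == f z then f w else f u.

Lemma swap_out f w z u : u \notin [set w; z; f w; f z] -> swap f w z u = f u.
Proof.
rewrite /swap !inE !negb_or -!andbA.
by case/and4P=> /negPf-> /negPf-> /negPf-> /negPf->.
Qed.

Lemma mem_swap f w z u : involutive f ->
  swap f w z u \in [set w; z; f w; f z] = (u \in [set w; z; f w; f z]).
Proof.
move=> fK; have f_inj := can_inj fK.
case: (boolP (u \in _)) => Hu.
  rewrite /swap; do 4?case: ifP => _; rewrite !inE ?eqxx ?orbT //; move: Hu.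
  by rewrite !inE => /orP[/orP[/orP[]|]|] /eqP->; rewrite ?fK ?eqxx ?orbT.
rewrite (swap_out Hu); apply: contraNF Hu; rewrite !inE.
by case/orP=> [/orP[/orP[]|]|] /eqP E; rewrite -?(f_inj _ _ E) -?E ?fK ?eqxx ?orbT.
Qed.

Lemma swapK f w z : involutive f -> w != z -> w != f w -> z != f z ->
  involutive (swap f w z).
Proof.
move=> fK /eqP wz /eqP wfw /eqP zfz u; have f_inj := can_inj fK.
have fwz : f w <> f z by move/f_inj.
have := fK w; have := fK z; have := fK u.
rewrite /swap; do ?case: eqP; congruence.
Qed.

Lemma swap_adj f w z v : (forall v, adj v (f v)) -> adj w z -> adj (f w) (f z) ->
  adj v (swap f w z v).
Proof.
move=> adjf wz fwz; rewrite /swap; case: eqP => [->|_] //.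
case: eqP => [->|_]; first by rewrite adj_sym.
by case: eqP => [->|_] //; case: eqP => [->|_] //; rewrite adj_sym.
Qed.

(* [s] lists the defective vertices treated so far, [g v] is the prescribed
   neighbour of [v], and [W] collects the vertices that were rematched. *)
Record rerouted (f g : V -> V) (W : {set V}) (s : seq V) : Prop := Rerouted {
  rerouted_inv : involutive f;
  rerouted_adj : forall v, adj v (f v);
  rerouted_out : forall v, v \notin W -> f v = f0 v;
  rerouted_fresh : forall v, v \in W ->
    [/\ v \notin defective, f0 v \notin defective & v \notin K];
  rerouted_closed : forall v, (f v \in W) = (v \in W);
  rerouted_card : #|W| <= 4 * size s;
  rerouted_link : forall v, v \in s -> (g v \in W) && link f v (g v);
  rerouted_disj : {in s &, forall v v', g v != f (g v')};
  rerouted_inj : {in s &, injective g} }.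

Lemma reroute s : uniq s -> {subset s <= defective} ->
  exists f g W, rerouted f g W s.
Proof.
elim: s => [|v s IHs].
  by move=> _ _; exists f0, id, set0; split=> //= [u|u|]; rewrite ?inE ?cards0.
case/andP=> vs Us Hs.
have vX : v \in defective by apply: Hs; rewrite mem_head.
have sX u : u \in s -> u \in defective by move=> Hu; apply: Hs; rewrite inE Hu orbT.
have size_s : size s < x.
  apply: leq_trans card_defective; rewrite -[(size s).+1]/(size (v :: s)).
  rewrite -(card_uniqP _); last by rewrite /= vs.
  by apply/subset_leq_card/subsetP.
have [f [g [W [fK adjf fout Wfresh Wf Wcard glink gdisj ginj]]]] := IHs Us sX.
have f_inj := can_inj fK.
(* [U] collects what a new switch must leave alone. Its complement is closed under [f], so keeping
   [w] and [z] outside [U] protects all four vertices of the switch. In [6 * x], the defective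
   vertices and their partners take [2 * x] and [W] takes [4 * x]. *)
pose U := defective :|: f0 @: defective :|: K :|: W.
have cardU : #|U| <= 6 * x + 2 * k.
  have [+ _] := leq_card_setU (defective :|: f0 @: defective :|: K) W.
  have [+ _] := leq_card_setU (defective :|: f0 @: defective) K.
  have [+ _] := leq_card_setU defective (f0 @: defective).
  have -> : #|f0 @: defective| = #|defective| by rewrite card_imset //; apply: can_inj f0K.
  rewrite -/U; move: card_defective cardK Wcard size_s => /=; lia.
have outU u : u \notin U ->
    [/\ u \notin defective, f0 u \notin defective, u \notin K & u \notin W].
  rewrite !in_setU !negb_or => /andP[/andP[/andP[-> H] ->] ->]; split=> //.
  by apply: contra H => /(imset_f f0); rewrite f0K.
have outU_f u : u \notin U -> f u = f0 u /\ f u \notin U.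
  case/outU=> H1 H2 H3 H4; have E := fout _ H4; split=> //; rewrite E.
  rewrite !in_setU !negb_or H2 K_f0 H3 -E Wf H4 !andbT E /=.
  by apply/imsetP => -[y Hy] /(can_inj f0K) E2; rewrite -E2 (negPf H1) in Hy.
have [w] : exists2 w, w \in [set w | adj v w] &
    w \notin U :|: [set y | F v [set v; f v] [set v; y]].
  apply: exists_outside; have [H _] := leq_card_setU U [set y | F v [set v; f v] [set v; y]].
  have := card_incompatible (adjf v).
  have := large_degree v; rewrite /degree; lia.
rewrite in_set in_setU negb_or => vw /andP[wU]; rewrite in_set => Fw.
have [wX _ _ _] := outU _ wU; have [fw fwU] := outU_f _ wU.
have [fwX _ _ _] := outU _ fwU.
have missw u : u \notin defective -> miss u <= t.
  by rewrite inE negb_or -leqNgt => /andP[].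
(* Outside the last set [f z] is a neighbour of [f w], which makes the switch possible. As [w] and
   [f w] are not defective, each costs at most [t], whence the [2 * t] of [large_m]. *)
have [z] : exists2 z, z \in [set z | adj w z] &
    z \notin U :|: [set y | F w [set w; v] [set w; y]]
      :|: f @: [set y | ((y \in A) != (f w \in A)) && ~~ adj (f w) y].
  apply: exists_outside.
  have [H1 _] := leq_card_setU (U :|: [set y | F w [set w; v] [set w; y]])
    (f @: [set y | ((y \in A) != (f w \in A)) && ~~ adj (f w) y]).
  have [H2 _] := leq_card_setU U [set y | F w [set w; v] [set w; y]].
  have wv : adj w v by rewrite adj_sym.
  have H3 := card_incompatible wv.
  rewrite (card_imset _ f_inj) -/(miss (f w)) in H1.
  have := missw _ wX; have := missw _ fwX.
  have := degree_miss w; rewrite /degree; lia.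
rewrite in_set 2!in_setU !negb_or => wz /andP[/andP[zU Fz] zim].
rewrite in_set in Fz.
have [fz fzU] := outU_f _ zU.
have fwfz : adj (f w) (f z).
  apply: contraR zim => Hn; apply/imsetP; exists (f z); last by rewrite fK.
  rewrite inE Hn andbT.
  move: (adj_side (adjf z)) (adj_side (adjf w)) (adj_side wz).
  by case: (z \in A); case: (f z \in A); case: (w \in A); case: (f w \in A).
have wz_neq a b : adj a b -> a != b.
  by move=> ab; apply/eqP=> E; move: (adj_side ab); rewrite E; case: (b \in A).
pose T := [set w; z; f w; f z]; pose f' := swap f w z.
have TU u : u \in T -> u \notin U.
  by case/setUP=> [/setUP[/setUP[]|]|] /set1P ->.
have f'_out u : u \notin T -> f' u = f u by exact: swap_out.
(* Defective vertices keep their matching edge and earlier rematched vertices their new one, so the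
   links found before survive the switch. *)
have XT u : u \in defective -> u \notin T.
  by apply: contraL => /TU/outU[].
have WT u : u \in W -> u \notin T.
  by apply: contraL => /TU/outU[].
pose g' u := if u == v then w else g u.
have g'_old u : u \in s -> g' u = g u.
  by move=> Hu; rewrite /g' (negPf (memPn vs u Hu)).
have g'_v : g' v = w by rewrite /g' eqxx.
have f'w : f' w = z by rewrite /f' /swap eqxx.
have f'g u : u \in s -> f' (g u) = f (g u).
  by move/glink=> /andP[/WT/f'_out].
have wT : w \in T by rewrite !inE eqxx.
have zT : z \in T by rewrite !inE eqxx orbT.
have gW u : u \in s -> g u \in W by case/glink/andP.
have wW : w \notin W by case/outU: wU.
have zW : z \notin W by case/outU: zU.
exists f', g', (W :|: T); split.
- by apply: swapK => //; apply: wz_neq.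
- by move=> u; apply: swap_adj.
- by move=> u; rewrite in_setU negb_or => /andP[/fout <- /f'_out].
- by move=> u; rewrite in_setU => /orP[/Wfresh//|/TU/outU[]].
- move=> u; rewrite (in_setU (f' u)) (in_setU u) [f' u \in T]mem_swap // -/T.
  case: (boolP (u \in T)) => Hu; rewrite ?orbT //.
  by rewrite !orbF f'_out.
- have [H _] := leq_card_setU W T; apply: leq_trans H _.
  rewrite /= mulnS addnC leq_add // /T -!setUA !cardsU1 cards1.
  by do 3!case: (_ \notin _).
- move=> u; rewrite inE => /orP[/eqP->|Hu].
    rewrite g'_v in_setU wT orbT /link vw f'_out ?XT // Fw f'w /=.
    by apply: contra Fz => /F_sym.
  rewrite g'_old // in_setU gW //= /link f'_out ?f'g ?XT ?sX //.
  by case/andP: (glink _ Hu).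
- move=> u u'; rewrite !inE => /orP[/eqP->|Hu] /orP[/eqP->|Hu'].
  + by rewrite g'_v f'w wz_neq.
  + rewrite g'_v g'_old // f'g //; apply: contraNneq wW => ->.
    by rewrite Wf gW.
  + by rewrite g'_v f'w g'_old //; apply: contraNneq zW => <-; rewrite gW.
  + by rewrite !g'_old // f'g // gdisj.
- move=> u u'; rewrite !inE => /orP[/eqP->|Hu] /orP[/eqP->|Hu'] //.
  + by rewrite g'_v g'_old // => E; rewrite E gW in wW.
  + by rewrite g'_v g'_old // => E; rewrite -E gW in wW.
  + by rewrite !g'_old //; apply: ginj.
Qed.

(** The summands account for non-neighbours ([t]), conflicts at [v] ([D]), conflicts at [y] with its
    old matching edge ([r]), and the vertices [y] of [W], whose matching edge may have changed
    ([4 * x]). *)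
Lemma card_nonlink f g W v :
  rerouted f g W (enum defective) -> v \notin defective ->
  #|[set y | ((y \in A) != (v \in A)) && ~~ link f v y]| <= t + D + r + 4 * x.
Proof.
case=> _ adjf fout _ _ cardW _ _ _.
rewrite inE negb_or -!leqNgt => /andP[missv backv].
pose M1 := [set y | ((y \in A) != (v \in A)) && ~~ adj v y].
pose M2 := [set y | F v [set v; f v] [set v; y]].
pose M3 := [set u | adj v u && F u [set u; f0 u] [set u; v]].
have [H1 _] := leq_card_setU (M1 :|: M2 :|: M3) W.
have [H2 _] := leq_card_setU (M1 :|: M2) M3.
have [H3 _] := leq_card_setU M1 M2.
have H4 : #|M2| <= D by apply: card_incompatible.
apply: (@leq_trans #|M1 :|: M2 :|: M3 :|: W|); last first.
  have H5 : #|W| <= 4 * x.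
    by apply: leq_trans cardW _; rewrite leq_mul2l -cardE card_defective orbT.
  move: missv backv; rewrite /miss /back -/M1 -/M3; lia.
apply/subset_leq_card/subsetP=> y; rewrite inE => /andP[side_y nl].
rewrite !in_setU [y \in M1]inE [y \in M2]inE [y \in M3]inE side_y /=.
move: nl; rewrite /link; case: (adj v y) => //=; rewrite negb_and !negbK.
case/orP=> [->|HF]; rewrite ?orbT //.
by case: (boolP (y \in W)) => [|/fout <-]; rewrite ?HF ?orbT.
Qed.

Lemma hamilton_link : exists f c,
  [/\ involutive f, forall v, adj v (f v), {in K, f =1 f0} &
      [/\ uniq c, c =i A & cycle (fun a a' => link f (f a) a') c]].
Proof.
have [|f [g [W Rfg]]] := @reroute (enum defective) (enum_uniq _).
  by move=> v; rewrite mem_enum.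
have dense := card_nonlink Rfg.
case: Rfg => fK adjf fout Wfresh Wf _ glink gdisj ginj.
have f_side v : (f v \in A) = (v \notin A) by rewrite (adj_side (adjf v)) negbK.
have f_inj := can_inj fK.
have memX v : v \in defective -> v \in enum defective by rewrite mem_enum.
have gW v : v \in defective -> g v \in W by move/memX/glink/andP=> [].
have gl v : v \in defective -> link f v (g v) by move/memX/glink/andP=> [].
have g_side v : v \in defective -> (g v \in A) = (v \notin A).
  by move/gl/and3P=> [/adj_side->]; rewrite negbK.
have link_sym u v : link f u v -> link f v u.
  by case/and3P=> H1 H2 H3; rewrite /link adj_sym H1 H2 H3.
have W_f v : v \in W -> f v \notin defective.
  by move=> Hv; have [] := Wfresh (f v) _; rewrite ?Wf.
have W_d v : v \in W -> v \notin defective by case/Wfresh.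
exists f.
(* An arc from [a] to [b] uses the edge from [f a] to [b]. So a defective [f a] prescribes the
   out-neighbour [g (f a)] of [a], and a defective [a] prescribes the in-neighbour [f (g a)], whose
   partner is [g a]. *)
have [||||||||||c [Uc cA Cc]] := @block_cycle _ (fun a a' => link f (f a) a') A
  [set a in A | f a \in defective] [set a in A | a \in defective]
  (fun a => g (f a)) (fun a => f (g a)) (t + D + r + 4 * x).
- by apply/subsetP=> a /setIdP[].
- by apply/subsetP=> a /setIdP[].
- move=> a /setIdP[aA aX]; rewrite g_side // f_side aA; split=> //.
  + by rewrite inE negb_and W_f ?orbT ?gW.
  + by rewrite inE negb_and W_d ?orbT ?gW.
  + exact: gl.
- move=> a /setIdP[aA aX]; rewrite f_side g_side // aA; split=> //.
  + by rewrite inE fK negb_and W_d ?orbT ?gW.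
  + by rewrite inE negb_and W_f ?orbT ?gW.
  + by rewrite fK; apply/link_sym/gl.
- move=> a b /setIdP[_ aX] /setIdP[_ bX] E; apply: f_inj.
  by apply: ginj => //; apply: memX.
- move=> a b /setIdP[_ aX] /setIdP[_ bX] /f_inj E.
  by apply: ginj => //; apply: memX.
- by move=> a b /setIdP[_ aX] /setIdP[_ bX]; apply: gdisj; apply: memX.
- move=> a aA aX; have faX : f a \notin defective by rewrite inE aA in aX.
  apply: leq_trans (dense _ faX); apply/subset_leq_card/subsetP=> y.
  by case/setIdP=> yA nl; rewrite inE f_side aA yA.
- move=> a aA aX; have aX' : a \notin defective by rewrite inE aA in aX.
  apply: leq_trans (dense _ aX'); rewrite -(card_imset _ f_inj).
  apply/subset_leq_card/subsetP=> y /imsetP[b /setIdP[bA nl] ->].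
  by rewrite inE f_side aA bA /=; apply: contra nl => /link_sym.
- rewrite cardA; apply: leq_ltn_trans very_large_m; rewrite leq_add2l mul2n -addnn.
  apply: leq_add; apply: leq_trans card_defective.
    rewrite -(card_imset _ f_inj); apply/subset_leq_card/subsetP=> y.
    by case/imsetP=> a /setIdP[_ H] ->.
  by apply/subset_leq_card/subsetP=> y /setIdP[].
exists c; split=> // v vK; apply: fout.
by apply: contraL vK => /Wfresh[].
Qed.

End Links.

(** * Double counting *)

Section Counting.
Variable V : finType.

(** Markov's inequality. The factor [t.+1] matters: it exceeds the real threshold of which [t] will
    be the truncation, while [t] may fall below it. *)
Lemma markov_card (h : V -> nat) t :
  #|[set v | t < h v]| * t.+1 <= \sum_v h v.
Proof.
rewrite -sum_nat_const [leqRHS](bigID (mem [set v | t < h v])) /=.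
by apply: leq_trans (leq_addr _ _); apply: leq_sum => v; rewrite inE.
Qed.

Lemma sum_card_exchange (P : rel V) :
  \sum_v #|[set u | P v u]| = \sum_u #|[set v | P v u]|.
Proof.
have E (Q : rel V) : \sum_v #|[set u | Q v u]| = \sum_v \sum_(u | Q v u) 1.
  by apply: eq_bigr => v _; rewrite -sum1_card; apply: eq_bigl => u; rewrite inE.
rewrite (E P) (E (fun u v => P v u)).
exact: (exchange_big_dep xpredT).
Qed.

Lemma sum_degree (adj : rel V) (A : {set V}) : symmetric adj ->
  (forall x y, adj x y -> (x \in A) = (y \notin A)) ->
  \sum_v degree adj v = 2 * e_between adj A (~: A).
Proof.
move=> adj_sym adj_side.
have E (S : {set V}) : \sum_(v in S) degree adj v =
    #|[set p : V * V | (p.1 \in S) && adj p.1 p.2]|.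
  rewrite (eq_bigr (fun v => \sum_(u | adj v u) 1)); last first.
    by move=> v _; rewrite /degree -sum1_card; apply: eq_bigl => u; rewrite inE.
  by rewrite pair_big_dep -sum1_card; apply: eq_bigl => p; rewrite inE.
rewrite (bigID (mem A)) /= (E A) mul2n -addnn; congr (_ + _).
  apply: eq_card => p; rewrite !inE; case: (boolP (adj _ _)); rewrite ?andbF //.
  by move/adj_side ->; rewrite !andbT andbb.
rewrite (eq_bigl (mem (~: A))); last by move=> v; rewrite /= inE.
have flip_inj : injective (fun p : V * V => (p.2, p.1)) by move=> [a b] [c d] [-> ->].
rewrite E -(card_imset _ flip_inj); apply: eq_card => -[x y]; rewrite inE /=.
apply/imsetP/and3P=> [[[a b]]|[xA yB xy]].
  rewrite !inE /= => /andP[aA ab] [-> ->]; rewrite adj_sym; split=> //.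
  by move: aA; rewrite (adj_side _ _ ab) negbK.
by exists (y, x); rewrite // inE /= yB adj_sym xy.
Qed.

End Counting.

(** * The involution of a perfect matching *)

Section Matching.
Variables (V : finType) (adj : rel V) (M : seq {set V}).
Hypothesis adj_simple : simple_graph adj.
Hypothesis matM : perfect_matching adj M.

Lemma matching_involution : exists f : V -> V,
  [/\ involutive f, forall v, adj v (f v) &
      forall e v, e \in M -> v \in e -> e = [set v; f v]].
Proof.
have [adj_sym adj_irr] := adj_simple; have [Medge Mdisj Mcover] := matM.
have Muniq e e' v : e \in M -> e' \in M -> v \in e -> v \in e' -> e = e'.
  move=> /(nthP set0)[i Hi <-] /(nthP set0)[j Hj <-] vi vj.
  case: (eqVneq i j) => [->//|ij]; have := Mdisj i j Hi Hj ij.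
  by move/setP/(_ v); rewrite !inE vi vj.
have ex v : exists u, ([set v; u] \in M) && adj v u.
  have [e eM ve] := Mcover v; have /existsP[x /existsP[y /andP[xy /eqP Ee]]] := Medge _ eM.
  move: ve eM; rewrite Ee !inE => /orP[]/eqP-> eM; first by exists y; rewrite eM.
  by exists x; rewrite setUC eM adj_sym.
pose f v := xchoose (ex v).
have fP v : ([set v; f v] \in M) && adj v (f v) := xchooseP (ex v).
have fM v : [set v; f v] \in M by case/andP: (fP v).
have adjf v : adj v (f v) by case/andP: (fP v).
exists f; split=> //; last first.
  by move=> e v eM ve; apply: (Muniq _ _ v) => //; rewrite set21.
(* The chosen edges at [v] and at [f v] share [f v], hence coincide; so [f (f v)] is [v] or [f v],
   and the latter would be a loop. *)
move=> v; have E := Muniq _ _ (f v) (fM v) (fM (f v)) (set22 _ _) (set21 _ _).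
move/setP: E => /(_ (f (f v))); rewrite !inE eqxx orbT => /orP[]/eqP // E.
by have := adjf (f v); rewrite E adj_irr.
Qed.

Lemma card_covered (f : V -> V) (s : seq {set V}) :
  #|[set v | [set v; f v] \in s]| <= 2 * size s.
Proof.
elim: s => [|e s IHs].
  by rewrite leqn0 cards_eq0 -subset0; apply/subsetP=> v; rewrite inE.
have -> : [set v | [set v; f v] \in e :: s] =
    [set v | [set v; f v] == e] :|: [set v | [set v; f v] \in s].
  by apply/setP=> v; rewrite !inE.
have [H _] := leq_card_setU [set v | [set v; f v] == e] [set v | [set v; f v] \in s].
apply: leq_trans H _; rewrite mulnS leq_add //.
case: (set_0Vmem [set v | [set v; f v] == e]) => [->|[v]]; first by rewrite cards0.
rewrite inE => /eqP Ev; apply: (@leq_trans #|e|); last first.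
  by rewrite -Ev cards2; case: (_ != _).
by apply/subset_leq_card/subsetP=> u; rewrite inE => /eqP <-; rewrite set21.
Qed.

End Matching.

(** * Numerical estimates and assembly *)

Local Open Scope ring_scope.

Theorem theorem3p5 (R : realType) (mu beta gamma : R)
  (V : finType) (adj : rel V) (A B : {set V}) (m : nat)
  (F : V -> {set V} -> {set V} -> bool) (M : seq {set V}) (k : nat) :
  0 < mu -> 0 < beta -> 0 < gamma ->
  gamma + beta + Num.sqrt mu < 1 / 2000 ->
  simple_graph adj -> bipartition adj A B ->
  #|A| = m -> #|B| = m -> (2 <= m)%N ->
  (forall v, (m%:R / 10 : R) <= (degree adj v)%:R) ->
  (1 - beta) * m%:R ^+ 2 <= (e_between adj A B)%:R ->
  incompat_system adj F -> bounded_sys F adj (mu * m%:R) ->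
  perfect_matching adj M -> size M = m ->
  k%:R <= gamma * m%:R ->
  exists s : seq V,
    [/\ hamilton_cycle adj s,
        forall e, e \in take k M -> e \in cycle_edges s &
        compatible_cycle F s].
Proof.
move=> mu_gt0 beta_gt0 gamma_gt0 small simpleG bipG cardA cardB m_ge2.
move=> min_deg edges F_sys F_bd matM sizeM k_le.
have [adj_sym adj_irr] := simpleG; have [AB0 ABT adj_bip] := bipG.
have defB : B = ~: A.
  apply/setP=> v; move/setP/(_ v): AB0; move/setP/(_ v): ABT; rewrite !inE.
  by case: (v \in A); case: (v \in B).
subst B.
have adj_side x y : adj x y -> (x \in A) = (y \notin A).
  by move/adj_bip; rewrite !inE; case: (x \in A); case: (y \in A).
have [f0 [f0K adj_f0 f0M]] := matching_involution simpleG matM.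
set q := Num.sqrt mu in small.
have q_gt0 : 0 < q by rewrite sqrtr_gt0.
have m_gt0 : 0 < m%:R :> R by rewrite ltr0n; lia.
pose D := Num.truncn (mu * m%:R); pose t := Num.truncn (m%:R / 10 : R).
pose r := Num.truncn (q * m%:R).
pose K := [set v | [set v; f0 v] \in take k M].
have K_f0 v : (f0 v \in K) = (v \in K) by rewrite !inE f0K setUC.
have cardK : (#|K| <= 2 * k)%N.
  apply: leq_trans (card_covered _ _) _; rewrite leq_mul2l size_take.
  by case: ltnP; lia.
have F_bound v e : is_edge adj e -> v \in e -> (#|[set e' | F v e e']| <= D)%N.
  move=> He Hv; rewrite /D truncn_ge_nat; first exact: F_bd.
  by rewrite mulr_ge0 ?ltW.
pose N1 := #|[set v | (t < miss adj A v)%N]|.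
pose N2 := #|[set v | (r < back adj F f0 v)%N]|.
pose X := defective adj A F t r f0.
have cardX : (#|X| <= N1 + N2)%N.
  have [H _] := leq_card_setU [set v | (t < miss adj A v)%N]
                              [set v | (r < back adj F f0 v)%N].
  apply: leq_trans H; apply/subset_leq_card/subsetP=> v.
  by rewrite !inE.
have cardV : #|V| = (2 * m)%N.
  by rewrite -(cardsC A) cardA cardB; lia.
(* Degree and [miss] add up to [m] at each of the [2 * m] vertices, so many edges force a small
   total of misses. *)
have N1_le : (N1 * t.+1 + 2 * e_between adj A (~: A) <= 2 * m * m)%N.
  rewrite -(sum_degree adj_sym adj_side).
  apply: (@leq_trans (\sum_v miss adj A v + \sum_v degree adj v)%N).
    by rewrite leq_add2r markov_card.
  rewrite -big_split /= (eq_bigr (fun=> m)) => [|v _].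
    by rewrite sum_nat_const cardV.
  by rewrite addnC (degree_miss adj_side cardA cardB).
(* Exchanging the sums fixes the far end [u], where at most [D] edges conflict with the matching
   edge. *)
have N2_le : (N2 * r.+1 <= 2 * m * D)%N.
  apply: leq_trans (markov_card _ _) _.
  rewrite (sum_card_exchange (fun v u => adj v u && F u [set u; f0 u] [set u; v])).
  rewrite -cardV -sum_nat_const; apply: leq_sum => u _.
  apply: leq_trans (card_incompatible F_bound (adj_f0 u)).
  by apply/subset_leq_card/subsetP=> v; rewrite !inE => /andP[].
set n := m%:R in m_gt0 min_deg edges k_le *.
have mu_q : mu = q * q by rewrite -expr2 sqr_sqrtr // ltW.
have D_le : D%:R <= q * (q * n) by rewrite mulrA -mu_q truncn_le mulr_ge0 ?ltW.
have t_le : t%:R <= n / 10 by rewrite truncn_le divr_ge0 ?ltW.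
have t_gt : n / 10 < t.+1%:R := truncnS_gt _.
have r_le : r%:R <= q * n by rewrite truncn_le mulr_ge0 ?ltW.
have r_gt : q * n < r.+1%:R := truncnS_gt _.
(* At most [2 * beta * n ^+ 2] misses, divided by the threshold [n / 10], give the factor 20. *)
have N1_le' : N1%:R <= 20 * (beta * n).
  have H : N1%:R * (n / 10) <= 2 * beta * n ^+ 2.
    apply: (@le_trans _ _ (N1%:R * t.+1%:R)); first by rewrite ler_wpM2l // ltW.
    by move: N1_le; rewrite -(ler_nat R) !natrD !natrM -/n; lra.
  rewrite -(ler_pM2r (_ : 0 < n / 10)); last by rewrite divr_gt0.
  by apply: le_trans H _; rewrite le_eqVlt; apply/orP; left; apply/eqP; field.
(* Since [mu = q * q], dividing by the threshold [q * n] still leaves a factor [q]; this is why the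
   threshold uses the square root. *)
have N2_le' : N2%:R <= 2 * (q * n).
  have H : N2%:R * (q * n) <= 2 * n * (q * (q * n)).
    apply: (@le_trans _ _ (N2%:R * r.+1%:R)); first by rewrite ler_wpM2l // ltW.
    move: N2_le; rewrite -(ler_nat R) !natrM -/n => /le_trans; apply.
    by rewrite ler_wpM2l // mulr_ge0 ?ltW.
  rewrite -(ler_pM2r (_ : 0 < q * n)); last by rewrite mulr_gt0.
  by apply: le_trans H _; rewrite le_eqVlt; apply/orP; left; apply/eqP; ring.
have sum_small : gamma * n + beta * n + q * n < n / 2000.
  by rewrite -!mulrDl mulrC -[X in _ < X]mulr1 -mulrA ltr_pM2l //; lra.
have bn_gt0 : 0 < beta * n by rewrite mulr_gt0.
have gn_gt0 : 0 < gamma * n by rewrite mulr_gt0.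
have qn_gt0 : 0 < q * n by rewrite mulr_gt0.
have D_le' : D%:R <= q * n.
  by apply: le_trans D_le _; rewrite ler_piMl ?ltW //; lra.
have x_le : #|X|%:R <= 20 * (beta * n) + 2 * (q * n).
  by move: cardX; rewrite -(ler_nat R) natrD; lra.
have [||||f [c [fK adjf ff0 [Uc cA Cc]]]] :=
  @hamilton_link V adj A F adj_sym adj_side F_sys m D t r k #|X| f0 K
    cardA cardB F_bound f0K adj_f0 K_f0 cardK.
- exact: leqnn.
- move=> v; have := min_deg v; rewrite -(ltr_nat R) !(natrD, natrM); lra.
- rewrite -(ltr_nat R) !(natrD, natrM) -/n; lra.
(* The left side is at most [n / 2 + 440 * (beta * n) + 54 * (q * n)], which [sum_small] keeps below
   [n]. *)
- rewrite -(ltr_nat R) !(natrD, natrM) -/n; lra.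
have [|ham inM compat] := link_cycle adj_side F_sys fK adjf Uc cA _ Cc.
  by rewrite cardA.
exists (expand f c); split=> // e eM.
(* A prescribed edge joins an end [v] to [f0 v]; as [v] lies in [K], this is also [f v], so the edge
   is on the cycle. *)
have [Medge _ _] := matM; have eM' := mem_take eM.
have /existsP[v /existsP[u /andP[_ /eqP Ee]]] := Medge _ eM'.
have ve : v \in e by rewrite Ee set21.
have Ev := f0M _ _ eM' ve.
by rewrite Ev -ff0 // inE -Ev.
Qed.
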